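(* For $n=1,2,3,4$ one has $Z(n)=n+\left[\frac{n+1}{2}\right]$, where $Z(n)$ is the maximal number of zeros in the open interval $(0,1)$ of the function $$\bar M(h)=\int_{\widehat{AA_1}}\big(q^{+}\,dx-p^{+}\,dy\big)+\int_{\widehat{A_1A}}\big(q^{-}\,dx-p^{-}\,dy\big),\qquad 0<h<1,$$ the maximum being taken over all real polynomials $p^{\pm}(x,y),q^{\pm}(x,y)$ of degree at most $n$ for which $\bar M$ is not identically zero on $(0,1)$.
   Context: $[\cdot]$ denotes the integer part. For $0<h<1$ put $A=(0,-\sqrt{1-h})$ and $A_1=(0,\sqrt{1-h})$. The arc $\widehat{AA_1}$ is the curve $x=1-\sqrt{h+y^2}$, $|y|\le\sqrt{1-h}$, traversed from $A$ to $A_1$; it is the orbit arc on $\frac12((x-1)^2-y^2)=\frac h2$, $x\ge0$. The arc $\widehat{A_1A}$ is the half circle $x^2+y^2=1-h$, $x\le 0$, traversed anticlockwise from $A_1$ to $A$. The function $\bar M$ is the first order Melnikov function of the piecewise system $\dot x=-y+\varepsilon p^+,\ \dot y=1-x+\varepsilon q^+$ for $x\ge0$; $\dot x=-y+\varepsilon p^-,\ \dot y=x+\varepsilon q^-$ for $x<0$. *)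

(* Defs.v *)
From Stdlib Require Import Reals List.
From Coquelicot Require Import Coquelicot.
Open Scope R_scope.

(* [f] is a real polynomial in two variables, of total degree at most [n]. *)
Definition poly2_le (n : nat) (f : R -> R -> R) : Prop :=
  exists a : nat -> nat -> R, forall x y : R,
    f x y = sum_f_R0 (fun i =>
              sum_f_R0 (fun j => a i j * x ^ i * y ^ j) (n - i)) n.

(* The integral of [P dx + Q dy] along the curve [t |-> (gx t, gy t)],
   with [t] running from [a] to [b]. *)
Definition line_integral (P Q : R -> R -> R) (gx gy : R -> R) (a b : R) : R :=
  RInt (fun t => P (gx t) (gy t) * Derive gx t + Q (gx t) (gy t) * Derive gy t)
    a b.

(* The hyperbola arc from [A = (0, - sqrt (1 - h))] to
   [A1 = (0, sqrt (1 - h))] is parametrized by [y]; the half circle from [A1]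
   to [A] in [x <= 0] by the polar angle, from [PI / 2] to [3 * PI / 2]. *)
Definition Mbar (pp qp pm qm : R -> R -> R) (h : R) : R :=
  line_integral qp (fun x y => - pp x y)
    (fun t => 1 - sqrt (h + t ^ 2)) (fun t => t)
    (- sqrt (1 - h)) (sqrt (1 - h))
  + line_integral qm (fun x y => - pm x y)
    (fun t => sqrt (1 - h) * cos t) (fun t => sqrt (1 - h) * sin t)
    (PI / 2) (3 * PI / 2).

Definition admissible (n : nat) (M : R -> R) : Prop :=
  (exists pp qp pm qm : R -> R -> R,
      poly2_le n pp /\ poly2_le n qp /\ poly2_le n pm /\ poly2_le n qm /\
      M = Mbar pp qp pm qm) /\
  (exists h : R, 0 < h < 1 /\ M h <> 0).

(* [f] has exactly [k] zeros in (0,1), counted without multiplicity; in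
   particular the set of these zeros is finite. *)
Definition zero_count (f : R -> R) (k : nat) : Prop :=
  exists l : list R,
    NoDup l /\ length l = k /\
    (forall h : R, In h l <-> (0 < h < 1 /\ f h = 0)).

(* [Z(n) = N] *)
Definition is_Z (n N : nat) : Prop :=
  (exists M : R -> R, admissible n M /\ zero_count M N) /\
  (forall M : R -> R, admissible n M ->
     exists k : nat, (k <= N)%nat /\ zero_count M k).

(* Main.v *)
Require Import Defs.
From Stdlib Require Import Reals List.
From Coquelicot Require Import Coquelicot.
From Stdlib Require Import Arith Lra Lia Sorted Classical ClassicalEpsilon.
Open Scope R_scope.

(* Put [r = sqrt (1 - h)] and [L = ln ((1 + r) / (1 - r))].  The half circle
   contributes the powers [r ^ k] with [1 <= k <= n + 1], and integration by
   parts along the hyperbola reduces its integrals to such powers and to the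
   products [h ^ m L] with [2 <= 2 m <= n + 1]; all of these are attained.

   Upper bound: divide by [h] to get [G = P / h + (a + b h) L], which vanishes
   at [r = 0].  If [b = 0] (as for [n <= 2]), [G' h ^ 2] is a polynomial in [r]
   with at most [n + 2] monomials, so it has at most [n + 1] positive zeros,
   and so does [G] by Rolle's theorem.  In general [G' / r] contains [L] only
   with a constant factor, and its derivative is a polynomial with 5 ([n = 3])
   or 6 ([n = 4]) monomials, up to a positive factor; here the terms in [r] and
   [r ^ 5] cancel.

   Lower bound: the functions above are linearly independent and one more in
   number than the bound, so some nonzero combination vanishes at as many
   prescribed points as the bound allows. *)

(** * Spans and line integrals *)

Lemma is_RInt_ext_all (f g : R -> R) a b (l : R) : (forall t, f t = g t) ->
  is_RInt f a b l -> is_RInt g a b l.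
Proof. intros E; apply is_RInt_ext; intros t _; apply E. Qed.

Definition logr (r : R) : R := ln (1 + r) - ln (1 - r).

(* Spans of functions of [r = sqrt (1 - h)], up to equality on (0,1). *)
Inductive span (d : nat) : (R -> R) -> Prop :=
| span_pow k : (1 <= k <= d)%nat -> span d (fun r => r ^ k)
| span_log m : (1 <= m)%nat -> (2 * m <= d)%nat ->
    span d (fun r => (1 - r ^ 2) ^ m * logr r)
| span_lin a b f g : span d f -> span d g ->
    span d (fun r => a * f r + b * g r)
| span_ext f g : span d f -> (forall r, 0 < r < 1 -> f r = g r) -> span d g.

Lemma span_le d e f : (d <= e)%nat -> span d f -> span e f.
Proof.
intros de H; induction H.
- apply span_pow; lia.
- apply span_log; lia.
- now apply span_lin.
- now apply span_ext with f.
Qed.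

Lemma span_scal d a f : span d f -> span d (fun r => a * f r).
Proof.
intros H; apply span_ext with (fun r => a * f r + 0 * f r).
- now apply span_lin.
- intros; ring.
Qed.

Lemma span_zero d : (1 <= d)%nat -> span d (fun _ => 0).
Proof.
intros H; apply span_ext with (fun r => 0 * r ^ 1).
- apply span_scal, span_pow; lia.
- intros; ring.
Qed.

(** Multiplication by [h] turns [r ^ k] into a difference of two powers and raises the exponent of
    [h] before the logarithm by one; either costs two degrees. *)
Lemma span_mulh d f : span d f -> span (d + 2) (fun r => (1 - r ^ 2) * f r).
Proof.
intros H; induction H.
- apply span_ext with (fun r => 1 * r ^ k + (-1) * r ^ (k + 2)).
  + apply span_lin; apply span_pow; lia.
  + intros r _; rewrite pow_add; ring.
- apply span_ext with (fun r => (1 - r ^ 2) ^ S m * logr r).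
  + apply span_log; lia.
  + intros r _; simpl; ring.
- apply span_ext with
    (fun r => a * ((1 - r ^ 2) * f r) + b * ((1 - r ^ 2) * g r)).
  + now apply span_lin.
  + intros; ring.
- apply span_ext with (1 := IHspan).
  intros r Hr; now rewrite H0.
Qed.

(** Stated with [is_RInt], so that integrability travels with the value and linear combinations need
    no side conditions. *)
Definition int_span (lo hi : R -> R) (d : nat) (phi : R -> R -> R) : Prop :=
  exists g, span d g /\
    forall r, 0 < r < 1 -> is_RInt (phi r) (lo r) (hi r) (g r).

Section IntSpan.
Variables lo hi : R -> R.
Local Notation isp := (int_span lo hi).

Lemma int_span_le d e phi : (d <= e)%nat -> isp d phi -> isp e phi.
Proof.
intros de [g [H1 H2]]; exists g; split; trivial.
now apply span_le with d.
Qed.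

Lemma int_span_ext d phi psi :
  (forall r t, 0 < r < 1 -> phi r t = psi r t) -> isp d phi -> isp d psi.
Proof.
intros E [g [H1 H2]]; exists g; split; trivial.
intros r Hr; apply is_RInt_ext_all with (phi r); auto.
Qed.

Lemma int_span_lin d a b phi psi : isp d phi -> isp d psi ->
  isp d (fun r t => a * phi r t + b * psi r t).
Proof.
intros [f [F1 F2]] [g [G1 G2]]; exists (fun r => a * f r + b * g r); split.
- now apply span_lin.
- intros r Hr.
  apply (is_RInt_plus (V := R_NormedModule)
    (fun t => a * phi r t) (fun t => b * psi r t));
  apply (is_RInt_scal (V := R_NormedModule)); auto.
Qed.

Lemma int_span_scal d a phi : isp d phi -> isp d (fun r t => a * phi r t).
Proof.
intros H; apply int_span_ext with (fun r t => a * phi r t + 0 * phi r t).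
- intros; ring.
- now apply int_span_lin.
Qed.

Lemma int_span_sum d (phi : nat -> R -> R -> R) N :
  (forall i, (i <= N)%nat -> isp d (phi i)) ->
  isp d (fun r t => sum_f_R0 (fun i => phi i r t) N).
Proof.
induction N as [|N IH]; intros H; simpl.
- apply int_span_ext with (phi O); auto.
- apply int_span_ext with (fun r t =>
    1 * sum_f_R0 (fun i => phi i r t) N + 1 * phi (S N) r t).
  + intros; ring.
  + apply int_span_lin; auto.
Qed.

Lemma int_span_mulh d phi : isp d phi ->
  isp (d + 2) (fun r t => (1 - r ^ 2) * phi r t).
Proof.
intros [g [H1 H2]]; exists (fun r => (1 - r ^ 2) * g r); split.
- now apply span_mulh.
- intros r Hr; apply (is_RInt_scal (V := R_NormedModule)); auto.
Qed.

(** Linearity reduces a polynomial integrand to monomials; the weight [w] carries the [dx] or [dy]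
    of the parametrization. *)
Lemma int_span_poly n d (f : R -> R -> R) (x y w : R -> R -> R) :
  poly2_le n f ->
  (forall i j, (i + j <= n)%nat ->
     isp d (fun r t => x r t ^ i * y r t ^ j * w r t)) ->
  isp d (fun r t => f (x r t) (y r t) * w r t).
Proof.
intros [a Ha] H.
apply int_span_ext with (fun r t => sum_f_R0 (fun i => sum_f_R0 (fun j =>
   a i j * (x r t ^ i * y r t ^ j * w r t)) (n - i)) n).
- intros r t _; rewrite Ha, (Rmult_comm _ (w r t)), scal_sum.
  apply sum_eq; intros i _.
  rewrite (Rmult_comm _ (w r t)), scal_sum.
  apply sum_eq; intros j _; ring.
- apply (int_span_sum d (fun i r t => sum_f_R0 (fun j =>
   a i j * (x r t ^ i * y r t ^ j * w r t)) (n - i))); intros i Hi.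
  apply (int_span_sum d (fun j r t =>
   a i j * (x r t ^ i * y r t ^ j * w r t))); intros j Hj.
  apply int_span_scal, H; lia.
Qed.

End IntSpan.

(** All powers of [r] leave the integral, including the one from [dx] or [dy]; the remaining
    trigonometric integral is a constant. *)
Lemma left_int_span i j (w : R -> R) : (forall t, continuous w t) ->
  int_span (fun _ => PI / 2) (fun _ => 3 * PI / 2) (i + j + 1)
    (fun r t => (r * cos t) ^ i * (r * sin t) ^ j * (r * w t)).
Proof.
intros Hw.
exists (fun r =>
  RInt (fun t => cos t ^ i * sin t ^ j * w t) (PI / 2) (3 * PI / 2)
  * r ^ (i + j + 1)); split.
- apply span_scal, span_pow; lia.
- intros r _.
  apply is_RInt_ext_all with
    (fun t => r ^ (i + j + 1) * (cos t ^ i * sin t ^ j * w t)).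
  + intros t; rewrite !Rpow_mult_distr, !pow_add; simpl; ring.
  + rewrite (Rmult_comm (RInt _ _ _)).
    apply (is_RInt_scal (V := R_NormedModule)), (RInt_correct (V := R_CompleteNormedModule)).
    apply (ex_RInt_continuous (V := R_CompleteNormedModule)); intros t _.
    apply (continuous_mult (K := R_AbsRing)); [|apply Hw].
    apply (ex_derive_continuous (fun t => cos t ^ i * sin t ^ j)).
    auto_derive; trivial.
Qed.

(** * Integrals along the hyperbola *)

(** With [h = 1 - r ^ 2] this is the root in the equation of the hyperbola arc, on which
    [x = 1 - hyp r t] and [y = t]. *)
Definition hyp (r t : R) : R := sqrt (1 - r ^ 2 + t ^ 2).

Lemma hyp_arg r t : 0 < r < 1 -> 0 < 1 - r ^ 2 + t ^ 2.
Proof. intros; nra. Qed.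

Lemma hyp_pos r t : 0 < r < 1 -> 0 < hyp r t.
Proof. intros; now apply sqrt_lt_R0, hyp_arg. Qed.

Lemma hyp_sq r t : 0 < r < 1 -> hyp r t * hyp r t = 1 - r ^ 2 + t ^ 2.
Proof. intros H; apply sqrt_sqrt, Rlt_le, hyp_arg, H. Qed.

Lemma hyp_end r : hyp r r = 1.
Proof. unfold hyp; replace (1 - r ^ 2 + r ^ 2) with 1 by ring; apply sqrt_1. Qed.

Lemma hyp_start r : hyp r (- r) = 1.
Proof.
unfold hyp; replace (1 - r ^ 2 + (- r) ^ 2) with 1 by ring; apply sqrt_1.
Qed.

Lemma hyp_derive r t : 0 < r < 1 -> is_derive (hyp r) t (t / hyp r t).
Proof.
intros H; unfold hyp; auto_derive.
- generalize (hyp_arg r t H); simpl; intros; lra.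
- replace (1 - r * (r * 1) + t * (t * 1)) with (1 - r ^ 2 + t ^ 2) by ring.
  fold (hyp r t); field; apply Rgt_not_eq, hyp_pos, H.
Qed.

Lemma hyp_ratio_continuous m j r t : 0 < r < 1 ->
  continuous (fun t => hyp r t ^ m * t ^ j / hyp r t) t.
Proof.
intros H; apply (ex_derive_continuous (fun t => hyp r t ^ m * t ^ j / hyp r t)).
assert (D : ex_derive (hyp r) t) by (eexists; apply hyp_derive, H).
auto_derive; repeat split; trivial.
apply Rgt_not_eq, hyp_pos, H.
Qed.

(** On the arc [dx = - (y / u) dy] with [u = hyp r y]; keeping the division by [u] lets one family
    serve both [dx] and [dy]. *)
Definition phi (m j : nat) (r t : R) : R := hyp r t ^ m * t ^ j / hyp r t.

Local Notation right_int := (int_span Ropp (fun r => r)).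

Lemma span_boundary j d : (S j <= d)%nat ->
  span d (fun r => r ^ S j - (- r) ^ S j).
Proof.
intros H.
apply span_ext with (fun r => (1 - (-1) ^ S j) * r ^ S j).
- apply span_scal, span_pow; lia.
- intros r _; replace (- r) with (-1 * r) by ring.
  rewrite Rpow_mult_distr; ring.
Qed.

(* Integration of [d (u ^ (k + 1) * y ^ (j + 1))], where [u = hyp r y] and
   [u du = y dy]; [u = 1] at both ends. *)
Lemma right_int_exact k j :
  right_int (k + j + 2) (fun r t =>
    INR (S k) * phi k (j + 2) r t + INR (S j) * phi (k + 2) j r t).
Proof.
exists (fun r => r ^ S j - (- r) ^ S j); split.
{ apply span_boundary; lia. }
intros r H.
assert (E : r ^ S j - (- r) ^ S j =
  minus (hyp r r ^ S k * r ^ S j) (hyp r (- r) ^ S k * (- r) ^ S j)).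
{ rewrite hyp_end, hyp_start, !pow1, !Rmult_1_l; reflexivity. }
rewrite E.
apply (is_RInt_derive (V := R_CompleteNormedModule)
  (fun t => hyp r t ^ S k * t ^ S j)).
- intros t _.
  assert (P := hyp_pos r t H).
  replace (INR (S k) * phi k (j + 2) r t + INR (S j) * phi (k + 2) j r t)
    with (INR (S k) * (t / hyp r t) * hyp r t ^ k * t ^ S j
          + hyp r t ^ S k * (INR (S j) * 1 * t ^ j)).
  + apply (is_derive_mult (K := R_AbsRing) (fun t => hyp r t ^ S k)
      (fun t => t ^ S j)).
    * apply (is_derive_pow (hyp r) (S k)), hyp_derive, H.
    * apply (is_derive_pow (fun t => t) (S j)), (is_derive_id (K := R_AbsRing)).
    * intros; apply Rmult_comm.
  + unfold phi; rewrite !pow_add; simpl (_ ^ S _); simpl (_ ^ 2).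
    field; lra.
- intros t _; apply (continuous_plus (V := R_NormedModule)
    (fun t => INR (S k) * phi k (j + 2) r t)
    (fun t => INR (S j) * phi (k + 2) j r t));
  apply (continuous_scal_r (K := R_AbsRing) (V := R_NormedModule)), hyp_ratio_continuous, H.
Qed.

(** Since [h = u ^ 2 - y ^ 2], one has [h * phi k j = phi (k + 2) j - phi k (j + 2)]; adding this
    [k + 1] times to the exact integrand eliminates [phi k (j + 2)]. *)
Lemma right_int_up k j : right_int (k + j + 2) (fun r t => (1 - r ^ 2) * phi k j r t) ->
  right_int (k + j + 2) (phi (k + 2) j).
Proof.
intros H.
apply int_span_ext with (fun r t => / INR (k + j + 2) *
  (INR (S k) * phi k (j + 2) r t + INR (S j) * phi (k + 2) j r t)
  + (INR (S k) / INR (k + j + 2)) * ((1 - r ^ 2) * phi k j r t)).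
- intros r t Hr.
  assert (P := hyp_pos r t Hr).
  replace (1 - r ^ 2) with (hyp r t * hyp r t - t ^ 2)
    by (rewrite hyp_sq by trivial; ring).
  unfold phi; rewrite !pow_add, !S_INR, !plus_INR; simpl (_ ^ 2); simpl (INR 2).
  generalize (pos_INR k) (pos_INR j); intros; field; lra.
- apply int_span_lin; trivial; apply right_int_exact.
Qed.

(** The same identity at [k = 0], now subtracted [j + 1] times so that [phi 2 j] drops out. It
    serves [m = 0], where [m] cannot be lowered by two. *)
Lemma right_int_right j : right_int (j + 2) (fun r t => (1 - r ^ 2) * phi 0 j r t) ->
  right_int (j + 2) (phi 0 (j + 2)).
Proof.
intros H.
apply int_span_ext with (fun r t => / INR (j + 2) *
  (INR 1 * phi 0 (j + 2) r t + INR (S j) * phi (0 + 2) j r t)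
  + (- INR (S j) / INR (j + 2)) * ((1 - r ^ 2) * phi 0 j r t)).
- intros r t Hr.
  assert (P := hyp_pos r t Hr).
  replace (1 - r ^ 2) with (hyp r t * hyp r t - t ^ 2)
    by (rewrite hyp_sq by trivial; ring).
  unfold phi; rewrite !pow_add, !S_INR, !plus_INR; simpl (_ ^ 2); simpl (INR _).
  simpl (_ ^ 0); generalize (pos_INR j); intros; field; lra.
- apply int_span_lin; trivial; apply (right_int_exact 0).
Qed.

(** The source of the logarithm: [1 / u] has the antiderivative [ln (y + u)], and [u = 1] at both
    ends. *)
Lemma right_int_phi00 : right_int 2 (fun r t => (1 - r ^ 2) * phi 0 0 r t).
Proof.
exists (fun r => (1 - r ^ 2) ^ 1 * logr r); split.
{ apply span_log; lia. }
intros r H; rewrite pow_1.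
apply (is_RInt_scal (V := R_NormedModule)).
replace (logr r) with (minus (ln (r + hyp r r)) (ln (- r + hyp r (- r)))).
2:{ rewrite hyp_end, hyp_start; unfold logr, minus, plus, opp; simpl.
    replace (- r + 1) with (1 - r) by ring. rewrite (Rplus_comm r 1); ring. }
apply (is_RInt_derive (V := R_CompleteNormedModule)
  (fun t => ln (t + hyp r t))).
- intros t _.
  assert (P := hyp_pos r t H).
  assert (D := hyp_derive r t H).
  assert (Q : 0 < t + hyp r t).
  { generalize (hyp_sq r t H); nra. }
  auto_derive.
  + split; [eexists; apply D|]; tauto.
  + rewrite (is_derive_unique (fun x : R => hyp r x) _ _ D); unfold phi; simpl; field; lra.
- intros t _; apply (hyp_ratio_continuous 0 0), H.
Qed.

Lemma right_int_phi01 : right_int 1 (phi 0 1).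
Proof.
exists (fun _ => 0); split.
{ apply span_zero; lia. }
intros r H.
replace 0 with (minus (hyp r r) (hyp r (- r))).
2:{ rewrite hyp_end, hyp_start; apply (minus_eq_zero (G := R_AbelianGroup)). }
apply (is_RInt_derive (V := R_CompleteNormedModule) (hyp r)).
- intros t _.
  replace (phi 0 1 r t) with (t / hyp r t)
    by (unfold phi; simpl; unfold Rdiv; ring).
  apply hyp_derive, H.
- intros t _; apply (hyp_ratio_continuous 0 1), H.
Qed.

Lemma right_int_phi1 j : right_int (1 + j) (phi 1 j).
Proof.
exists (fun r => / INR (S j) * (r ^ S j - (- r) ^ S j)); split.
{ apply span_scal, span_boundary; lia. }
intros r H.
apply is_RInt_ext_all with (fun t => / INR (S j) * (INR (S j) * 1 * t ^ j)).
- intros t; assert (P := hyp_pos r t H); unfold phi; rewrite pow_1.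
  assert (N : INR (S j) <> 0) by (apply not_0_INR; lia).
  field; lra.
- apply (is_RInt_scal (V := R_NormedModule)).
  apply (is_RInt_derive (V := R_CompleteNormedModule) (fun t => t ^ S j)).
  + intros t _.
    apply (is_derive_pow (fun t => t) (S j)), (is_derive_id (K := R_AbsRing)).
  + intros t _; apply (ex_derive_continuous (fun t => INR (S j) * 1 * t ^ j)).
    auto_derive; trivial.
Qed.

(* For [m = j = 0] only the multiple by [h = 1 - r ^ 2] is in the span: the
   integral itself is [logr r]. *)
Lemma right_int_phi m j :
  ((1 <= m + j)%nat -> right_int (m + j) (phi m j)) /\
  right_int (m + j + 2) (fun r t => (1 - r ^ 2) * phi m j r t).
Proof.
revert j; induction m as [m IH] using lt_wf_ind; intros j.
enough (H : (1 <= m + j)%nat -> right_int (m + j) (phi m j)).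
{ split; trivial.
  destruct (Nat.eq_dec (m + j) 0) as [E|E].
  - assert (m = O) by lia; assert (j = O) by lia; subst.
    apply right_int_phi00.
  - apply int_span_mulh, H; lia. }
destruct m as [|[|m]].
- induction j as [j IHj] using lt_wf_ind; intros Hj.
  destruct j as [|[|j]]; [lia|apply right_int_phi01|].
  replace (S (S j)) with (j + 2)%nat by lia.
  apply right_int_right.
  (* At [j = 0] only the product of [phi 0 0] with [h] is at hand, and the reduction asks for no
     more. *)
  destruct j as [|j]; [apply right_int_phi00|].
  apply (int_span_mulh _ _ (S j)), (IHj (S j)); lia.
- intros _; apply right_int_phi1.
- intros _; replace (S (S m)) with (m + 2)%nat by lia.
  replace (m + 2 + j)%nat with (m + j + 2)%nat by lia.
  apply right_int_up, IH; lia.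
Qed.

(** Expand one factor [1 - u] at a time, using [u * phi m j = phi (m + 1) j]. As [m] only grows, the
    exceptional [phi 0 0] never appears. *)
Lemma right_int_span i m j : (1 <= m + j)%nat ->
  right_int (i + m + j) (fun r t => (1 - hyp r t) ^ i * phi m j r t).
Proof.
revert m; induction i as [|i IH]; intros m H.
- apply int_span_ext with (phi m j).
  + intros; simpl; ring.
  + now apply right_int_phi.
- apply int_span_ext with (fun r t =>
    1 * ((1 - hyp r t) ^ i * phi m j r t)
    + (-1) * ((1 - hyp r t) ^ i * phi (S m) j r t)).
  + intros; unfold phi, Rdiv; simpl; ring.
  + apply int_span_lin.
    * apply int_span_le with (i + m + j)%nat; [lia|]; auto.
    * replace (S i + m + j)%nat with (i + S m + j)%nat by lia.
      apply IH; lia.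
Qed.

(** * The Melnikov function *)

Definition right_integrand (p q : R -> R -> R) (r t : R) : R :=
  q (1 - hyp r t) t * - (t / hyp r t) - p (1 - hyp r t) t.

Definition left_integrand (p q : R -> R -> R) (r t : R) : R :=
  q (r * cos t) (r * sin t) * (r * - sin t)
  - p (r * cos t) (r * sin t) * (r * cos t).

Lemma sqrt_one_minus h : 0 < h < 1 -> 0 < sqrt (1 - h) < 1.
Proof.
intros H; split; [apply sqrt_lt_R0; lra|].
rewrite <- sqrt_1 at 2; apply sqrt_lt_1_alt; lra.
Qed.

Lemma Mbar_eq pp qp pm qm h v w : 0 < h < 1 ->
  is_RInt (right_integrand pp qp (sqrt (1 - h)))
    (- sqrt (1 - h)) (sqrt (1 - h)) v ->
  is_RInt (left_integrand pm qm (sqrt (1 - h))) (PI / 2) (3 * PI / 2) w ->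
  Mbar pp qp pm qm h = v + w.
Proof.
intros Hh Hv Hw; unfold Mbar, line_integral.
assert (S : sqrt (1 - h) ^ 2 = 1 - h) by (apply pow2_sqrt; lra).
assert (E : forall t, sqrt (h + t ^ 2) = hyp (sqrt (1 - h)) t).
{ intros t; unfold hyp; rewrite S; f_equal; ring. }
assert (Hr := sqrt_one_minus h Hh).
f_equal; apply is_RInt_unique.
- apply is_RInt_ext_all with (2 := Hv); intros t; unfold right_integrand.
  rewrite (Derive_ext _ (fun t => 1 - hyp (sqrt (1 - h)) t))
    by (intros; now rewrite E).
  rewrite E, Derive_id.
  replace (Derive _ t) with (- (t / hyp (sqrt (1 - h)) t)).
  + unfold Rminus; now rewrite Rmult_1_r.
  + assert (D := hyp_derive _ t Hr).
    rewrite (Derive_minus (fun _ => 1) (hyp (sqrt (1 - h)))).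
    * rewrite Derive_const, (is_derive_unique _ _ _ D); ring.
    * apply ex_derive_const.
    * eexists; apply D.
- apply is_RInt_ext_all with (2 := Hw); intros t; unfold left_integrand.
  rewrite !Derive_scal.
  rewrite (is_derive_unique cos t (- sin t)) by apply is_derive_cos.
  rewrite (is_derive_unique sin t (cos t)) by apply is_derive_sin.
  unfold Rminus; now rewrite Ropp_mult_distr_l.
Qed.

Lemma Mbar_in_span n pp qp pm qm :
  poly2_le n pp -> poly2_le n qp -> poly2_le n pm -> poly2_le n qm ->
  exists g, span (n + 1) g /\
    forall h, 0 < h < 1 -> Mbar pp qp pm qm h = g (sqrt (1 - h)).
Proof.
intros Hpp Hqp Hpm Hqm.
assert (HR : right_int (n + 1) (right_integrand pp qp)).
{ apply int_span_ext with (fun r t =>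
    1 * (qp (1 - hyp r t) t * - (t / hyp r t))
    + (-1) * (pp (1 - hyp r t) t * 1)).
  { intros; unfold right_integrand; ring. }
  apply int_span_lin.
  - apply (int_span_poly _ _ n (n + 1) qp (fun r t => 1 - hyp r t)
      (fun r t => t) (fun r t => - (t / hyp r t))); trivial.
    intros i j Hij.
    (* The factor [y / u] of [dx] raises the power of [y] to [j + 1], which avoids [phi 0 0]; for
       [dy] below, [1 = u / u] gives [m = 1]. *)
    apply int_span_le with (i + 0 + S j)%nat; [lia|].
    apply int_span_ext with (fun r t =>
      (-1) * ((1 - hyp r t) ^ i * phi 0 (S j) r t)).
    + intros; unfold phi, Rdiv; simpl; ring.
    + apply int_span_scal, right_int_span; lia.
  - apply (int_span_poly _ _ n (n + 1) pp (fun r t => 1 - hyp r t)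
      (fun r t => t) (fun r t => 1)); trivial.
    intros i j Hij.
    apply int_span_le with (i + 1 + j)%nat; [lia|].
    apply int_span_ext with (fun r t => (1 - hyp r t) ^ i * phi 1 j r t).
    + intros r t Hr; assert (P := hyp_pos r t Hr).
      unfold phi; rewrite pow_1; field; lra.
    + apply right_int_span; lia. }
assert (HL : int_span (fun _ => PI / 2) (fun _ => 3 * PI / 2) (n + 1)
  (left_integrand pm qm)).
{ apply int_span_ext with (fun r t =>
    1 * (qm (r * cos t) (r * sin t) * (r * - sin t))
    + (-1) * (pm (r * cos t) (r * sin t) * (r * cos t))).
  { intros; unfold left_integrand; ring. }
  apply int_span_lin.
  - apply (int_span_poly _ _ n (n + 1) qm (fun r t => r * cos t)
      (fun r t => r * sin t) (fun r t => r * - sin t)); trivial.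
    intros i j Hij.
    apply int_span_le with (i + j + 1)%nat; [lia|].
    apply (left_int_span i j (fun t => - sin t)).
    intros t; apply (ex_derive_continuous (fun t => - sin t)).
    auto_derive; trivial.
  - apply (int_span_poly _ _ n (n + 1) pm (fun r t => r * cos t)
      (fun r t => r * sin t) (fun r t => r * cos t)); trivial.
    intros i j Hij.
    apply int_span_le with (i + j + 1)%nat; [lia|].
    apply left_int_span; intros t; apply continuous_cos. }
destruct HR as [g1 [S1 I1]]; destruct HL as [g2 [S2 I2]].
exists (fun r => 1 * g1 r + 1 * g2 r); split.
{ now apply span_lin. }
intros h Hh; assert (Hr := sqrt_one_minus h Hh).
rewrite !Rmult_1_l; apply Mbar_eq; auto.
Qed.

(** * Every function of the span is attained *)

Lemma sum_delta N k (f : nat -> R) : (k <= N)%nat ->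
  sum_f_R0 (fun i => (if Nat.eqb i k then 1 else 0) * f i) N = f k.
Proof.
assert (Z : forall M, (M < k)%nat ->
  sum_f_R0 (fun i => (if Nat.eqb i k then 1 else 0) * f i) M = 0).
{ intros M HM; rewrite (sum_eq _ (fun _ => 0)).
  - rewrite sum_cte; ring.
  - intros i Hi; destruct (Nat.eqb_spec i k); [lia|ring]. }
induction N as [|N IH]; intros H.
- replace k with O by lia; simpl; ring.
- rewrite tech5; destruct (Nat.eqb_spec (S N) k) as [E|E].
  + rewrite Z by lia; rewrite <- E; ring.
  + rewrite IH by lia; ring.
Qed.

Lemma poly2_ext n f g : (forall x y, f x y = g x y) ->
  poly2_le n f -> poly2_le n g.
Proof.
intros E [a H]; exists a; intros; now rewrite <- E.
Qed.

Lemma poly2_lin n a b f g : poly2_le n f -> poly2_le n g ->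
  poly2_le n (fun x y => a * f x y + b * g x y).
Proof.
intros [c Hc] [d Hd]; exists (fun i j => a * c i j + b * d i j).
intros x y; rewrite Hc, Hd, !scal_sum, <- sum_plus.
apply sum_eq; intros i _; rewrite (Rmult_comm _ a), (Rmult_comm _ b).
rewrite !scal_sum, <- sum_plus.
apply sum_eq; intros; ring.
Qed.

Lemma poly2_pow n k : (k <= n)%nat -> poly2_le n (fun x _ => x ^ k).
Proof.
intros H.
exists (fun i j => (if Nat.eqb i k then 1 else 0)
                   * (if Nat.eqb j 0 then 1 else 0)).
intros x y; rewrite <- (sum_delta n k (fun i => x ^ i)) by trivial.
apply sum_eq; intros i _.
apply eq_trans with ((if Nat.eqb i k then 1 else 0) * (x ^ i * y ^ 0)).
- simpl; ring.
- rewrite <- (sum_delta (n - i) 0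
    (fun j => (if Nat.eqb i k then 1 else 0) * (x ^ i * y ^ j))) by lia.
  apply sum_eq; intros; ring.
Qed.

Lemma poly2_zero n : poly2_le n (fun _ _ => 0).
Proof.
apply poly2_ext with (fun x y => 0 * x ^ 0 + 0 * x ^ 0).
- intros; ring.
- apply poly2_lin; apply poly2_pow; lia.
Qed.

(** Phrased in [r], with separate values for the two arcs, so that linear combinations act on each
    integral. *)
Definition realized (n : nat) (g : R -> R) : Prop :=
  exists pp qp pm qm : R -> R -> R,
    poly2_le n pp /\ poly2_le n qp /\ poly2_le n pm /\ poly2_le n qm /\
    exists g1 g2 : R -> R, forall r, 0 < r < 1 ->
      is_RInt (right_integrand pp qp r) (- r) r (g1 r) /\
      is_RInt (left_integrand pm qm r) (PI / 2) (3 * PI / 2) (g2 r) /\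
      g r = g1 r + g2 r.

Lemma realized_ext n f g : (forall r, 0 < r < 1 -> f r = g r) ->
  realized n f -> realized n g.
Proof.
intros E (pp & qp & pm & qm & H1 & H2 & H3 & H4 & g1 & g2 & H).
exists pp, qp, pm, qm; repeat split; trivial.
exists g1, g2; intros r Hr; rewrite <- E by trivial; auto.
Qed.

Lemma realized_lin n a b f g : realized n f -> realized n g ->
  realized n (fun r => a * f r + b * g r).
Proof.
intros (pp & qp & pm & qm & H1 & H2 & H3 & H4 & f1 & f2 & H)
  (pp' & qp' & pm' & qm' & H1' & H2' & H3' & H4' & g1 & g2 & H').
exists (fun x y => a * pp x y + b * pp' x y),
  (fun x y => a * qp x y + b * qp' x y),
  (fun x y => a * pm x y + b * pm' x y),
  (fun x y => a * qm x y + b * qm' x y).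
repeat (split; [now apply poly2_lin|]).
exists (fun r => a * f1 r + b * g1 r), (fun r => a * f2 r + b * g2 r).
intros r Hr; destruct (H r Hr) as (F1 & F2 & F).
destruct (H' r Hr) as (G1 & G2 & G); repeat split.
- apply is_RInt_ext_all with (fun t => a * right_integrand pp qp r t
    + b * right_integrand pp' qp' r t).
  { intros t; unfold right_integrand.
    ring. }
  apply (is_RInt_plus (V := R_NormedModule)
    (fun t => a * right_integrand pp qp r t)
    (fun t => b * right_integrand pp' qp' r t));
  now apply (is_RInt_scal (V := R_NormedModule)).
- apply is_RInt_ext_all with (fun t => a * left_integrand pm qm r t
    + b * left_integrand pm' qm' r t).
  { intros t; unfold left_integrand; ring. }
  apply (is_RInt_plus (V := R_NormedModule)
    (fun t => a * left_integrand pm qm r t)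
    (fun t => b * left_integrand pm' qm' r t));
  now apply (is_RInt_scal (V := R_NormedModule)).
- rewrite F, G; ring.
Qed.

Lemma realized_scal n a f : realized n f -> realized n (fun r => a * f r).
Proof.
intros H; apply realized_ext with (fun r => a * f r + 0 * f r).
- intros; ring.
- now apply realized_lin.
Qed.

Lemma is_RInt_zero (f : R -> R) a b : (forall t, f t = 0) -> is_RInt f a b 0.
Proof.
intros H; apply is_RInt_ext_all with (fun _ => 0).
- intros; now rewrite H.
- assert (I : is_RInt (fun _ => 0) a b ((b - a) * 0))
    by apply (is_RInt_const (V := R_NormedModule)).
  now rewrite Rmult_0_r in I.
Qed.

(** Only [p^- = (-x) ^ (k - 1)] is taken nonzero: [- p^- dy] integrates to [r ^ k * c], and [c > 0]
    because [- cos t] is positive inside the half circle. *)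
Lemma realized_pow n k : (1 <= k <= n + 1)%nat -> realized n (fun r => r ^ k).
Proof.
intros H.
set (c := RInt (fun t => (- cos t) ^ k) (PI / 2) (3 * PI / 2)).
assert (C : forall t, continuous (fun t => (- cos t) ^ k) t).
{ intros t; apply (ex_derive_continuous (fun t => (- cos t) ^ k)).
  auto_derive; trivial. }
assert (Hc : 0 < c).
{ assert (P := PI_RGT_0).
  apply RInt_gt_0; [lra| |intros; apply C].
  intros t Ht; apply pow_lt.
  assert (cos t < 0) by (apply cos_lt_0; lra); lra. }
apply realized_ext with (fun r => / c * (r ^ k * c)).
{ intros; field; lra. }
apply realized_scal.
exists (fun _ _ => 0), (fun _ _ => 0),
  (fun x y => (-1) ^ (k - 1) * x ^ (k - 1) + 0 * x ^ (k - 1)), (fun _ _ => 0).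
do 2 (split; [apply poly2_zero|]).
split; [apply (poly2_lin n ((-1) ^ (k - 1)) 0 (fun x _ => x ^ (k - 1))
  (fun x _ => x ^ (k - 1))); apply poly2_pow; lia|].
split; [apply poly2_zero|].
exists (fun _ => 0), (fun r => r ^ k * c); intros r Hr; repeat split.
- apply is_RInt_zero; intros t; unfold right_integrand; ring.
- apply is_RInt_ext_all with (fun t => r ^ k * (- cos t) ^ k).
  + intros t; unfold left_integrand.
    replace k with (S (k - 1)) at 1 2 by lia.
    replace (- cos t) with (-1 * cos t) by ring.
    rewrite !Rpow_mult_distr, <- !tech_pow_Rmult.
    ring.
  + apply (is_RInt_scal (V := R_NormedModule)),
      (RInt_correct (V := R_CompleteNormedModule)).
    apply (ex_RInt_continuous (V := R_CompleteNormedModule)); intros; apply C.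
- ring.
Qed.

Lemma is_RInt_hyp r : 0 < r < 1 ->
  is_RInt (hyp r) (- r) r (r + (1 - r ^ 2) * logr r / 2).
Proof.
intros H.
(* The classical antiderivative of [sqrt (h + t ^ 2)]; its logarithmic part produces
   [h * logr r / 2]. *)
set (f t := (t * hyp r t + (1 - r ^ 2) * ln (t + hyp r t)) / 2).
replace (r + (1 - r ^ 2) * logr r / 2) with (minus (f r) (f (- r))).
2:{ unfold f; rewrite hyp_end, hyp_start; unfold logr, minus, plus, opp; simpl.
    replace (- r + 1) with (1 - r) by ring; rewrite (Rplus_comm r 1); field. }
apply (is_RInt_derive (V := R_CompleteNormedModule)); intros t _.
- assert (P := hyp_pos r t H).
  assert (D := hyp_derive r t H).
  assert (Q := hyp_sq r t H).
  assert (Q' : 0 < t + hyp r t) by nra.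
  unfold f; auto_derive.
  + repeat split; try (eexists; apply D); trivial.
  + rewrite (is_derive_unique (fun x : R => hyp r x) _ _ D).
    replace (1 - r * (r * 1)) with (hyp r t * hyp r t - t * t)
      by (rewrite Q; ring).
    field; lra.
- apply (ex_derive_continuous (hyp r)); eexists; apply hyp_derive, H.
Qed.

(** The derivative of [t * u ^ 3 / 4] is [u ^ 3 / 4 + 3 / 4 * t ^ 2 * u], that is
    [u ^ 3 - 3 / 4 * h * u], which reduces the claim to [is_RInt_hyp]; the boundary terms give
    [r / 2]. *)
Lemma is_RInt_hyp3 r : 0 < r < 1 ->
  is_RInt (fun t => hyp r t ^ 3) (- r) r
    (r / 2 + 3 / 4 * (1 - r ^ 2) * (r + (1 - r ^ 2) * logr r / 2)).
Proof.
intros H.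
assert (E : r / 2 = minus (r * hyp r r ^ 3 / 4) (- r * hyp r (- r) ^ 3 / 4)).
{ rewrite hyp_end, hyp_start; unfold minus, plus, opp; simpl; field. }
rewrite E.
apply is_RInt_ext_all with (fun t =>
  (hyp r t ^ 3 / 4 + 3 / 4 * t ^ 2 * hyp r t)
  + 3 / 4 * (1 - r ^ 2) * hyp r t).
{ intros t.
  replace (1 - r ^ 2) with (hyp r t * hyp r t - t ^ 2)
    by (rewrite hyp_sq by trivial; ring).
  field. }
apply (is_RInt_plus (V := R_NormedModule)
  (fun t => hyp r t ^ 3 / 4 + 3 / 4 * t ^ 2 * hyp r t)
  (fun t => 3 / 4 * (1 - r ^ 2) * hyp r t)).
2: now apply (is_RInt_scal (V := R_NormedModule)), is_RInt_hyp.
assert (D : forall t, is_derive (hyp r) t (t / hyp r t))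
  by (intros; now apply hyp_derive).
apply (is_RInt_derive (V := R_CompleteNormedModule)
  (fun t => t * hyp r t ^ 3 / 4)); intros t _.
- assert (P := hyp_pos r t H).
  auto_derive.
  + eexists; apply D.
  + rewrite (is_derive_unique (fun x : R => hyp r x) _ _ (D t)).
    simpl; field; lra.
- apply (ex_derive_continuous
    (fun t => hyp r t ^ 3 / 4 + 3 / 4 * t ^ 2 * hyp r t)).
  auto_derive; repeat split; eexists; apply D.
Qed.

Lemma realized_right n p (g : R -> R) : poly2_le n p ->
  (forall r, 0 < r < 1 -> is_RInt (fun t => p (1 - hyp r t) t) (- r) r (g r)) ->
  realized n g.
Proof.
intros Hp H.
exists (fun x y => (-1) * p x y + 0 * p x y), (fun _ _ => 0), (fun _ _ => 0),
  (fun _ _ => 0).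
split; [now apply poly2_lin|].
do 3 (split; [apply poly2_zero|]).
exists g, (fun _ => 0); intros r Hr; repeat split; [| |ring].
- apply is_RInt_ext_all with (2 := H r Hr).
  intros; unfold right_integrand; ring.
- apply is_RInt_zero; intros t; unfold left_integrand; ring.
Qed.

(** On the arc [1 - x = u], so the polynomial [1 - x] yields the integral of [u]; the power of [r]
    in it is subtracted. *)
Lemma realized_log1 n : (1 <= n)%nat ->
  realized n (fun r => (1 - r ^ 2) ^ 1 * logr r).
Proof.
intros Hn.
apply realized_ext with
  (fun r => 2 * (r + (1 - r ^ 2) * logr r / 2) + (-2) * r ^ 1).
{ intros; field. }
apply (realized_lin n 2 (-2) (fun r => r + (1 - r ^ 2) * logr r / 2)).
2: apply realized_pow; lia.
apply realized_right with (fun x _ => 1 * x ^ 0 + (-1) * x ^ 1).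
- apply (poly2_lin n 1 (-1) (fun x _ => x ^ 0) (fun x _ => x ^ 1));
    apply poly2_pow; lia.
- intros r Hr; apply is_RInt_ext_all with (2 := is_RInt_hyp r Hr).
  intros; simpl; ring.
Qed.

(** On the arc [(1 - x) ^ 3 = u ^ 3], whose integral is [3 / 8 * h ^ 2 * logr r + 5 / 4 * r - 3 / 4
    * r ^ 3]; scale by [8 / 3] and remove the powers. *)
Lemma realized_log2 n : (3 <= n)%nat ->
  realized n (fun r => (1 - r ^ 2) ^ 2 * logr r).
Proof.
intros Hn.
apply realized_ext with (fun r =>
  8 / 3 * (r / 2 + 3 / 4 * (1 - r ^ 2) * (r + (1 - r ^ 2) * logr r / 2))
  + 1 * (- 10 / 3 * r ^ 1 + 2 * r ^ 3)).
{ intros; field. }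
apply (realized_lin n (8 / 3) 1 (fun r =>
  r / 2 + 3 / 4 * (1 - r ^ 2) * (r + (1 - r ^ 2) * logr r / 2))).
2: apply (realized_lin n (- 10 / 3) 2 (fun r => r ^ 1) (fun r => r ^ 3));
     apply realized_pow; lia.
apply realized_right with (fun x _ =>
  1 * (1 * x ^ 0 + (-3) * x ^ 1) + 1 * (3 * x ^ 2 + (-1) * x ^ 3)).
- apply (poly2_lin n 1 1 (fun x _ => 1 * x ^ 0 + (-3) * x ^ 1)
    (fun x _ => 3 * x ^ 2 + (-1) * x ^ 3)).
  + apply (poly2_lin n 1 (-3) (fun x _ => x ^ 0) (fun x _ => x ^ 1));
      apply poly2_pow; lia.
  + apply (poly2_lin n 3 (-1) (fun x _ => x ^ 2) (fun x _ => x ^ 3));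
      apply poly2_pow; lia.
- intros r Hr; apply is_RInt_ext_all with (2 := is_RInt_hyp3 r Hr).
  intros; simpl; ring.
Qed.

Lemma span_realized n g : (n <= 4)%nat -> span (n + 1) g -> realized n g.
Proof.
intros Hn H; induction H.
- now apply realized_pow.
(* [2 * m <= n + 1 <= 5] leaves only [m = 1] and [m = 2]. *)
- destruct m as [|[|[|m]]]; [lia| | |lia].
  + apply realized_log1; lia.
  + apply realized_log2; lia.
- now apply realized_lin.
- now apply realized_ext with f.
Qed.

Lemma realized_Mbar n g : realized n g ->
  exists pp qp pm qm : R -> R -> R,
    poly2_le n pp /\ poly2_le n qp /\ poly2_le n pm /\ poly2_le n qm /\
    forall h, 0 < h < 1 -> Mbar pp qp pm qm h = g (sqrt (1 - h)).
Proof.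
intros (pp & qp & pm & qm & H1 & H2 & H3 & H4 & g1 & g2 & H).
exists pp, qp, pm, qm; repeat (split; trivial).
intros h Hh; destruct (H _ (sqrt_one_minus h Hh)) as (I1 & I2 & ->).
now apply Mbar_eq.
Qed.

(** * Counting zeros *)

(** The points [z 0 < ... < z k] come as a sequence, so that Rolle's theorem applies to neighbours
    by index. *)
Definition at_most (f : R -> R) (k : nat) : Prop :=
  forall z : nat -> R, (forall i, (i < k)%nat -> z i < z (S i)) ->
    ~ (forall i, (i <= k)%nat -> 0 < z i < 1 /\ f (z i) = 0).

Definition few_zeros (f : R -> R) (k : nat) : Prop :=
  (forall x, 0 < x < 1 -> f x = 0) \/ at_most f k.

Lemma few_zeros_iff f g k : (forall x, 0 < x < 1 -> f x = 0 <-> g x = 0) ->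
  few_zeros f k -> few_zeros g k.
Proof.
intros E [H|H]; [left|right].
- intros x Hx; now apply E, H.
- intros z inc Z; apply (H z inc); intros i Hi.
  destruct (Z i Hi) as [Z1 Z2]; split; trivial; now apply E.
Qed.

Lemma few_zeros_ext f g k : (forall x, f x = g x) ->
  few_zeros f k -> few_zeros g k.
Proof. intros E; apply few_zeros_iff; intros x _; now rewrite E. Qed.

Lemma rolle_points (f f' : R -> R) (z : nat -> R) k :
  (forall i, (i <= k)%nat -> z i < z (S i) /\ f (z i) = f (z (S i)) /\
     forall x, z i <= x <= z (S i) -> is_derive f x (f' x)) ->
  exists y : nat -> R,
    forall i, (i <= k)%nat -> z i < y i < z (S i) /\ f' (y i) = 0.
Proof.
intros H.
assert (C : forall i, exists c,
  (i <= k)%nat -> z i < c < z (S i) /\ f' c = 0).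
(* Indices beyond [k] receive the default [0]. *)
{ intros i; destruct (le_dec i k) as [Hi|Hi]; [|exists 0; tauto].
  destruct (H i Hi) as (L & E & D).
  destruct (MVT_cor2 f f' (z i) (z (S i)) L) as (c & Hc & Lc).
  - intros c Hc; apply is_derive_Reals, D, Hc.
  - exists c; intros _; split; trivial.
    rewrite E, Rminus_diag in Hc; symmetry in Hc.
    apply Rmult_integral in Hc; destruct Hc; lra. }
exists (fun i => proj1_sig (constructive_indefinite_description _ (C i))).
intros i; exact (proj2_sig (constructive_indefinite_description _ (C i))).
Qed.

(** If [f'] vanishes identically, [f] is constant, so a single zero makes it zero throughout;
    otherwise Rolle's theorem between neighbouring zeros. *)
Lemma few_zeros_rolle f f' k :
  (forall x, 0 < x < 1 -> is_derive f x (f' x)) ->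
  few_zeros f' k -> few_zeros f (S k).
Proof.
intros D [H|H].
- destruct (classic (exists x, 0 < x < 1 /\ f x = 0)) as [[x [Hx Z]]|N].
  + left.
    assert (C : forall a b, 0 < a -> a < b -> b < 1 -> f a = f b).
    { intros a b Ha Hab Hb.
      destruct (MVT_cor2 f f' a b Hab) as (c & Hc & Lc).
      - intros c Hc; apply is_derive_Reals, D; lra.
      - rewrite H in Hc; lra. }
    intros y Hy; destruct (Rtotal_order x y) as [L|[E|L]].
    * rewrite <- Z; symmetry; apply C; lra.
    * now subst.
    * rewrite <- Z; apply C; lra.
  + right; intros z _ Z; apply N; exists (z O); apply Z; lia.
- right; intros z inc Z.
  destruct (rolle_points f f' z k) as [y Hy].
  + intros i Hi; split; [|split].
    * apply inc; lia.
    * rewrite (proj2 (Z i ltac:(lia))), (proj2 (Z (S i) ltac:(lia))); trivial.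
    * intros x Hx; apply D.
      destruct (Z i ltac:(lia)), (Z (S i) ltac:(lia)); lra.
  + apply (H y).
    * intros i Hi; apply Rlt_trans with (z (S i));
        [apply (Hy i)|apply (Hy (S i))]; lia.
    * intros i Hi; destruct (Hy i Hi); split; trivial.
      destruct (Z i ltac:(lia)), (Z (S i) ltac:(lia)); lra.
Qed.

(** The known zero at the end [0] supplies one more interval for Rolle's theorem, so differentiation
    does not raise the bound. *)
Lemma few_zeros_rolle0 f f' k :
  (forall x, 0 <= x < 1 -> is_derive f x (f' x)) -> f 0 = 0 ->
  few_zeros f' k -> few_zeros f k.
Proof.
intros D F0 [H|H].
- left; intros x Hx.
  destruct (MVT_cor2 f f' 0 x (proj1 Hx)) as (c & Hc & Lc).
  + intros c Hc; apply is_derive_Reals, D; lra.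
  + rewrite H in Hc; lra.
- right; intros z inc Z.
  (* The zero at [0] is put in front, which shifts the indices by one. *)
  set (z' i := match i with O => 0 | S j => z j end).
  assert (B : forall i, (i <= S k)%nat -> 0 <= z' i < 1 /\ f (z' i) = 0).
  { intros [|i] Hi; simpl; [lra|]. destruct (Z i ltac:(lia)); lra. }
  destruct (rolle_points f f' z' k) as [y Hy].
  + intros i Hi; split; [|split].
    * destruct i; simpl; [apply (Z O); lia|apply inc; lia].
    * rewrite (proj2 (B i ltac:(lia))), (proj2 (B (S i) ltac:(lia))); trivial.
    * intros x Hx; apply D.
      destruct (B i ltac:(lia)), (B (S i) ltac:(lia)); lra.
  + apply (H y).
    * intros i Hi; apply Rlt_trans with (z' (S i));
        [apply (Hy i)|apply (Hy (S i))]; lia.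
    * intros i Hi; destruct (Hy i Hi); split; trivial.
      destruct (B i ltac:(lia)), (B (S i) ltac:(lia)); lra.
Qed.

(** * Sparse polynomials *)

Definition sparse (l : list (R * nat)) (x : R) : R :=
  fold_right (fun ce s => fst ce * x ^ snd ce + s) 0 l.

(** The weak order survives [pred] and truncated subtraction, both of which are monotone. *)
Definition exp_le (a b : R * nat) : Prop := (snd a <= snd b)%nat.

Lemma StronglySorted_map (A : Type) (P : A -> A -> Prop) (f : A -> A) l :
  (forall a b, P a b -> P (f a) (f b)) ->
  StronglySorted P l -> StronglySorted P (map f l).
Proof.
intros H S; induction S; simpl; constructor; trivial.
apply Forall_map; revert H0; apply Forall_impl; auto.
Qed.

Lemma sparse_derive l x : is_derive (sparse l) x
  (sparse (map (fun ce => (fst ce * INR (snd ce), pred (snd ce))) l) x).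
Proof.
induction l as [|[c e] l IH]; simpl.
- apply (is_derive_const (K := R_AbsRing) 0).
- apply (is_derive_plus (fun x => c * x ^ e) (sparse l)); trivial.
  replace (c * INR e * x ^ Init.Nat.pred e)
    with (c * (INR e * 1 * x ^ Init.Nat.pred e)) by ring.
  apply (is_derive_scal (fun x => x ^ e)), (is_derive_pow (fun x => x)),
    (is_derive_id (K := R_AbsRing)).
Qed.

Lemma sparse_shift e l x : List.Forall (fun ce => (e <= snd ce)%nat) l ->
  sparse l x = x ^ e * sparse (map (fun ce => (fst ce, (snd ce - e)%nat)) l) x.
Proof.
intros H; induction H as [|[c d] l H _ IH]; simpl; [ring|].
rewrite IH; simpl in H; replace d with (e + (d - e))%nat at 1 by lia.
rewrite pow_add; ring.
Qed.

(* Descartes' bound in terms of the number of monomials: divide by the lowest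
   power of [x], then differentiate. *)
Lemma sparse_few_zeros k l : (length l <= S k)%nat ->
  StronglySorted exp_le l -> few_zeros (sparse l) k.
Proof.
revert l; induction k as [|k IH]; intros [|[c e] l] Hl Hs;
  try (left; reflexivity); simpl in Hl.
- destruct l; [|simpl in Hl; lia].
  destruct (Req_dec c 0) as [E|E].
  + left; intros x _; simpl; rewrite E; ring.
  + right; intros z _ Z; destruct (Z O (le_n _)) as [Hz E'].
    simpl in E'; apply E.
    assert (P : 0 < z O ^ e) by (apply pow_lt; lra). nra.
- apply StronglySorted_inv in Hs; destruct Hs as [Hs Hf].
  set (l' := map (fun ce => (fst ce, (snd ce - e)%nat)) l).
  apply few_zeros_iff with (fun x => c + sparse l' x).
  { intros x Hx; simpl; rewrite (sparse_shift e l) by exact Hf; fold l'.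
    assert (P : 0 < x ^ e) by (apply pow_lt; lra).
    replace (c * x ^ e + x ^ e * sparse l' x)
      with (x ^ e * (c + sparse l' x)) by ring.
    split; [intros ->; ring|].
    intros E; apply Rmult_integral in E; destruct E; lra. }
  apply few_zeros_rolle with (sparse (map
    (fun ce => (fst ce * INR (snd ce), pred (snd ce))) l')).
  { intros x _.
    apply is_derive_ext with (fun x => sparse l' x + c).
    { intros; apply Rplus_comm. }
    rewrite <- (Rplus_0_r (sparse _ x)).
    apply (is_derive_plus (sparse l') (fun _ => c)).
    - apply sparse_derive.
    - apply (is_derive_const (K := R_AbsRing) c). }
  apply IH.
  + unfold l'; rewrite !length_map; lia.
  + apply StronglySorted_map.
    { unfold exp_le; simpl; intros; lia. }
    apply StronglySorted_map; trivial.
    unfold exp_le; simpl; intros; lia.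
Qed.

(** * The family of Melnikov functions *)

Lemma derive_zero f x l : (forall y, 0 < y < 1 -> f y = 0) -> 0 < x < 1 ->
  is_derive f x l -> l = 0.
Proof.
intros Z Hx D.
rewrite <- (is_derive_unique _ _ _ D), <- (Derive_const 0 x).
apply Derive_ext_loc, (locally_interval _ x 0 1); simpl; try lra.
intros; now apply Z.
Qed.

Lemma sparse_eq_zero c0 c2 c3 c4 c6 c8 :
  (forall x, 0 < x < 1 -> sparse ((c0, 0%nat) :: (c2, 2%nat) :: (c3, 3%nat) ::
     (c4, 4%nat) :: (c6, 6%nat) :: (c8, 8%nat) :: nil) x = 0) ->
  c0 = 0 /\ c2 = 0 /\ c3 = 0 /\ c4 = 0 /\ c6 = 0 /\ c8 = 0.
Proof.
intros Z.
(* Six positive points for six exponents: the generalized Vandermonde matrix is regular, and [lra]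
   solves the system. *)
assert (E1 := Z (1/7) ltac:(lra)); assert (E2 := Z (2/7) ltac:(lra)).
assert (E3 := Z (3/7) ltac:(lra)); assert (E4 := Z (4/7) ltac:(lra)).
assert (E5 := Z (5/7) ltac:(lra)); assert (E6 := Z (6/7) ltac:(lra)).
cbn [sparse fold_right fst snd] in E1, E2, E3, E4, E5, E6.
repeat split; lra.
Qed.

Section Form.
Variables p1 p2 p3 p4 p5 a b : R.

(** The general element of the span for [n = 4]; smaller [n] set some coefficients to zero. *)
Definition form (r : R) : R :=
  p1 * r + p2 * r ^ 2 + p3 * r ^ 3 + p4 * r ^ 4 + p5 * r ^ 5
  + a * ((1 - r ^ 2) * logr r) + b * ((1 - r ^ 2) ^ 2 * logr r).

(** After division by [h] the logarithm has a factor linear in [h], of which differentiation leaves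
    only [- 2 * b * r]. *)
Definition form_div (r : R) : R :=
  (p1 * r + p2 * r ^ 2 + p3 * r ^ 3 + p4 * r ^ 4 + p5 * r ^ 5) / (1 - r ^ 2)
  + (a + b * (1 - r ^ 2)) * logr r.

Definition form_num (r : R) : R := sparse
  ((p1 + 2 * a + 2 * b, 0%nat) :: (2 * p2, 1%nat) ::
   (3 * p3 + p1 - 2 * a - 4 * b, 2%nat) :: (4 * p4, 3%nat) ::
   (2 * b - p3 + 5 * p5, 4%nat) :: (- 2 * p4, 5%nat) ::
   (- 3 * p5, 6%nat) :: nil) r.

Definition form_div_derive (r : R) : R :=
  form_num r / (1 - r ^ 2) ^ 2 - 2 * b * r * logr r.

Definition form_ratio (r : R) : R :=
  form_num r / (r * (1 - r ^ 2) ^ 2) - 2 * b * logr r.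

(** Numerator of the derivative of [form_ratio]: a term [c * r ^ k] of [form_num] contributes [(k -
    1) * c * r ^ k + (5 - k) * c * r ^ (k + 2)], the logarithm [- 4 * b * r ^ 2 * (1 - r ^ 2) ^ 2].
    In [r ^ 5] the contributions of [4 * p4] and [- 2 * p4] cancel. *)
Definition form_num2 (r : R) : R := sparse
  ((- (p1 + 2 * a + 2 * b), 0%nat) ::
   (6 * p1 + 3 * p3 + 8 * a + 2 * b, 2%nat) ::
   (8 * p2 + 8 * p4, 3%nat) ::
   (3 * p1 + 6 * p3 + 15 * p5 - 6 * a + 2 * b, 4%nat) ::
   (- p3 - 10 * p5 - 2 * b, 6%nat) :: (3 * p5, 8%nat) :: nil) r.

Lemma form_div_eq r : 0 < r < 1 -> form r = (1 - r ^ 2) * form_div r.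
Proof. intros H; unfold form, form_div; field; nra. Qed.

Lemma form_div_0 : form_div 0 = 0.
Proof. unfold form_div, logr; rewrite Rplus_0_r, Rminus_0_r, ln_1; field. Qed.

Lemma form_div_is_derive r : 0 <= r < 1 ->
  is_derive form_div r (form_div_derive r).
Proof.
intros H; assert (P : 0 < 1 - r ^ 2) by nra.
unfold form_div, form_div_derive, form_num, sparse, logr; auto_derive; simpl in *.
- repeat split; lra.
- change (ln (1 + - r)) with (ln (1 - r)); field; repeat split; lra.
Qed.

Lemma form_ratio_is_derive r : 0 < r < 1 ->
  is_derive form_ratio r (form_num2 r / (r ^ 2 * (1 - r ^ 2) ^ 3)).
Proof.
intros H; assert (P : 0 < 1 - r ^ 2) by nra.
unfold form_ratio, form_num2, form_num, sparse, logr; simpl in *; auto_derive.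
- repeat split; try lra. apply Rgt_not_eq; repeat apply Rmult_gt_0_compat; lra.
- change (ln (1 + - r)) with (ln (1 - r)); field; repeat split; lra.
Qed.

Lemma form_few_zeros k : few_zeros form_div_derive k -> few_zeros form k.
Proof.
intros H; apply few_zeros_iff with form_div.
{ intros x Hx; rewrite form_div_eq by trivial; split; [intros ->; ring|].
  intros E; apply Rmult_integral in E; destruct E; trivial; nra. }
apply few_zeros_rolle0 with form_div_derive; trivial.
- apply form_div_is_derive.
- apply form_div_0.
Qed.

Lemma form_few_zeros1 k : b = 0 -> few_zeros form_num k -> few_zeros form k.
Proof.
intros Hb H; apply form_few_zeros.
apply few_zeros_iff with (2 := H); intros x Hx.
unfold form_div_derive; rewrite Hb.
assert (P : 0 < 1 - x ^ 2) by nra.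
split; [intros ->; field; lra|].
intros E; replace (form_num x) with ((1 - x ^ 2) ^ 2 *
  (form_num x / (1 - x ^ 2) ^ 2 - 2 * 0 * x * logr x)) by (field; lra).
rewrite E; ring.
Qed.

(** Of the two differentiations only the second costs a zero, since [form_div] vanishes at [0]. *)
Lemma form_few_zeros2 k : few_zeros form_num2 k -> few_zeros form (S k).
Proof.
intros H; apply form_few_zeros.
apply few_zeros_iff with form_ratio.
{ intros x Hx; assert (P : 0 < 1 - x ^ 2) by nra.
  replace (form_div_derive x) with (x * form_ratio x)
    by (unfold form_ratio, form_div_derive; field; lra).
  split; [intros ->; ring|].
  intros E; apply Rmult_integral in E; destruct E; lra. }
apply few_zeros_rolle with (1 := form_ratio_is_derive).
apply few_zeros_iff with (2 := H); intros x Hx.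
assert (P : 0 < 1 - x ^ 2) by nra.
split; [intros ->; field; lra|].
intros E; replace (form_num2 x) with ((x ^ 2 * (1 - x ^ 2) ^ 3) *
  (form_num2 x / (x ^ 2 * (1 - x ^ 2) ^ 3))) by (field; lra).
rewrite E; ring.
Qed.

(** Linear independence, by the same two differentiations: [form_num2] vanishes, hence so do its six
    coefficients. *)
Lemma form_zero : (forall r, 0 < r < 1 -> form r = 0) ->
  p1 = 0 /\ p2 = 0 /\ p3 = 0 /\ p4 = 0 /\ p5 = 0 /\ a = 0 /\ b = 0.
Proof.
intros Z.
assert (Z1 : forall r, 0 < r < 1 -> form_div r = 0).
{ intros r Hr; assert (P : 0 < 1 - r ^ 2) by nra.
  specialize (Z r Hr); rewrite form_div_eq in Z by trivial.
  apply Rmult_integral in Z; destruct Z; trivial; lra. }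
assert (Z2 : forall r, 0 < r < 1 -> form_ratio r = 0).
{ intros r Hr; assert (P : 0 < 1 - r ^ 2) by nra.
  replace (form_ratio r) with (form_div_derive r / r)
    by (unfold form_ratio, form_div_derive; field; lra).
  rewrite (derive_zero form_div r (form_div_derive r)); trivial.
  - field; lra.
  - apply form_div_is_derive; lra. }
assert (Z3 : forall r, 0 < r < 1 -> form_num2 r = 0).
{ intros r Hr; assert (P : 0 < 1 - r ^ 2) by nra.
  assert (E := derive_zero _ r _ Z2 Hr (form_ratio_is_derive r Hr)).
  replace (form_num2 r) with ((r ^ 2 * (1 - r ^ 2) ^ 3) *
    (form_num2 r / (r ^ 2 * (1 - r ^ 2) ^ 3))) by (field; lra).
  rewrite E; ring. }
destruct (sparse_eq_zero _ _ _ _ _ _ Z3) as (E0 & E2 & E3 & E4 & E6 & E8).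
assert (p1 = 0) by lra. assert (p3 = 0) by lra. assert (p5 = 0) by lra.
assert (a = 0) by lra. assert (b = 0) by lra.
assert (p2 + p4 = 0) by lra.
(* Only [p2 + p4] is known so far: [r ^ 2 - r ^ 4] divided by [h] is [r ^ 2], which the
   differentiations kill. A value of [form] separates the two. *)
assert (E := Z (1/2) ltac:(lra)); unfold form in E.
replace a with 0 in E by lra; replace b with 0 in E by lra.
repeat split; lra.
Qed.

End Form.

(** * Prescribing zeros *)

Lemma sum_lin (f g : nat -> R) a b N :
  sum_f_R0 (fun i => a * f i + b * g i) N
  = a * sum_f_R0 f N + b * sum_f_R0 g N.
Proof.
rewrite !scal_sum, <- sum_plus; apply sum_eq; intros; ring.
Qed.

(* [n] homogeneous linear equations in [n + 1] unknowns; the induction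
   eliminates the last unknown by means of the last equation, after adding
   another unknown to it if its coefficient there is zero. *)
Lemma homogeneous_solution n (f : nat -> nat -> R) :
  exists c : nat -> R, (exists i, (i <= n)%nat /\ c i <> 0) /\
    forall j, (j < n)%nat -> sum_f_R0 (fun i => c i * f i j) n = 0.
Proof.
revert f; induction n as [|n IH]; intros f.
{ exists (fun _ => 1); split; [exists O; split; [lia|lra]|lia]. }
assert (P : forall f : nat -> nat -> R, f (S n) n <> 0 ->
  exists c : nat -> R, (exists i, (i <= S n)%nat /\ c i <> 0) /\
    forall j, (j < S n)%nat -> sum_f_R0 (fun i => c i * f i j) (S n) = 0).
{ clear f; intros f Hf.
  (* The last unknown, solved from equation [n], is substituted into the other equations. *)
  destruct (IH (fun i j => f i j - f i n / f (S n) n * f (S n) j))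
    as (c & (k & Hk & Ck) & H).
  set (s := sum_f_R0 (fun i => c i * f i n) n).
  exists (fun i => if Nat.eqb i (S n) then - s / f (S n) n else c i).
  split.
  - exists k; split; [lia|].
    destruct (Nat.eqb_spec k (S n)); [lia|trivial].
  - intros j Hj; rewrite tech5, Nat.eqb_refl.
    rewrite (sum_eq _ (fun i => c i * f i j)).
    2:{ intros i Hi; destruct (Nat.eqb_spec i (S n)); [lia|trivial]. }
    destruct (Nat.eq_dec j n) as [->|E].
    + fold s; field; trivial.
    + specialize (H j ltac:(lia)).
      rewrite (sum_eq _ (fun i => 1 * (c i * f i j)
        + (- f (S n) j / f (S n) n) * (c i * f i n))) in H
        by (intros; field; trivial).
      rewrite sum_lin in H; fold s in H.
      rewrite <- H; field; trivial. }
destruct (Req_dec (f (S n) n) 0) as [E|E]; [|now apply P].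
destruct (classic (exists p, (p <= n)%nat /\ f p n <> 0)) as [(p & Hp & Fp)|N].
(* Column [p] is added to the last column, whose entry in equation [n] becomes nonzero; a solution
   [c] for [g] is carried back by adding [c (S n)] to entry [p]. *)
- set (g := fun i j => if Nat.eqb i (S n) then f (S n) j + f p j else f i j).
  assert (G : forall j, g (S n) j = f (S n) j + f p j).
  { intros j; unfold g; now rewrite Nat.eqb_refl. }
  assert (G' : forall i j, (i <= n)%nat -> g i j = f i j).
  { intros i j Hi; unfold g; destruct (Nat.eqb_spec i (S n)); [lia|trivial]. }
  destruct (P g) as (c & (k & Hk & Ck) & H).
  { rewrite G, E; lra. }
  exists (fun i => 1 * c i + c (S n) * (if Nat.eqb i p then 1 else 0)).
  split.
  + destruct (Nat.eqb_spec k p) as [->|Ek].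
    * destruct (Req_dec (c (S n)) 0) as [Z|Z].
      -- exists p; split; [lia|]; rewrite Z; lra.
      -- exists (S n); split; [lia|].
         destruct (Nat.eqb_spec (S n) p); [lia|lra].
    * exists k; split; [lia|].
      destruct (Nat.eqb_spec k p); [lia|lra].
  + intros j Hj; apply eq_trans with (2 := H j Hj).
    rewrite (sum_eq _ (fun i => 1 * (c i * f i j)
      + c (S n) * ((if Nat.eqb i p then 1 else 0) * f i j)))
      by (intros; ring).
    rewrite sum_lin, (sum_delta (S n) p (fun i => f i j)) by lia.
    rewrite !tech5, G, (sum_eq (fun i => c i * g i j) (fun i => c i * f i j)).
    * ring.
    * intros i Hi; now rewrite G'.
(* Equation [n] is trivial here: drop it and set the last unknown to [0]. *)
- destruct (IH f) as (c & (k & Hk & Ck) & H).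
  exists (fun i => if Nat.eqb i (S n) then 0 else c i); split.
  + exists k; split; [lia|].
    destruct (Nat.eqb_spec k (S n)); [lia|trivial].
  + intros j Hj; rewrite tech5, Nat.eqb_refl, Rmult_0_l, Rplus_0_r.
    rewrite (sum_eq _ (fun i => c i * f i j)).
    2:{ intros i Hi; destruct (Nat.eqb_spec i (S n)); [lia|trivial]. }
    destruct (Nat.eq_dec j n) as [->|Ej]; [|apply H; lia].
    rewrite (sum_eq _ (fun _ => 0)).
    * rewrite sum_cte; ring.
    * intros i Hi; destruct (Req_dec (f i n) 0) as [->|F]; [ring|].
      elim N; now exists i.
Qed.

(** One sequence for all generators: [r, ..., r ^ (n + 1)], then [h ^ m * logr r] with
    [m = i - n]. *)
Definition basis (n i : nat) (r : R) : R :=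
  if Nat.leb i n then r ^ S i else (1 - r ^ 2) ^ (i - n) * logr r.

(** The last index is included, so there is one coefficient more than the bound on the zeros. *)
Definition comb (n : nat) (c : nat -> R) (r : R) : R :=
  sum_f_R0 (fun i => c i * basis n i r) (n + (n + 1) / 2).

Lemma half_le n m : (m <= (n + 1) / 2 <-> 2 * m <= n + 1)%nat.
Proof.
split; intros H.
- generalize (Nat.div_mod_eq (n + 1) 2); lia.
- apply Nat.div_le_lower_bound; lia.
Qed.

Lemma span_comb n f : span (n + 1) f ->
  exists c, forall r, 0 < r < 1 -> f r = comb n c r.
Proof.
intros H; induction H.
- exists (fun i => if Nat.eqb i (k - 1) then 1 else 0); intros r _.
  unfold comb; rewrite (sum_delta _ _ (fun i => basis n i r)) by lia.
  unfold basis; destruct (Nat.leb_spec (k - 1) n); [|lia].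
  now replace (S (k - 1)) with k by lia.
- exists (fun i => if Nat.eqb i (n + m) then 1 else 0); intros r _.
  apply half_le in H0.
  unfold comb; rewrite (sum_delta _ _ (fun i => basis n i r)) by lia.
  unfold basis; destruct (Nat.leb_spec (n + m) n); [lia|].
  now replace (n + m - n)%nat with m by lia.
- destruct IHspan1 as [c1 H1], IHspan2 as [c2 H2].
  exists (fun i => a * c1 i + b * c2 i); intros r Hr.
  rewrite H1, H2 by trivial; unfold comb; rewrite <- sum_lin.
  apply sum_eq; intros; ring.
- destruct IHspan as [c Hc]; exists c; intros r Hr.
  rewrite <- H0 by trivial; auto.
Qed.

Lemma span_sum d (f : nat -> R -> R) N : (forall i, (i <= N)%nat -> span d (f i)) ->
  span d (fun r => sum_f_R0 (fun i => f i r) N).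
Proof.
induction N as [|N IH]; intros H; simpl.
- now apply (H O).
- apply span_ext with (fun r => 1 * sum_f_R0 (fun i => f i r) N + 1 * f (S N) r).
  + apply span_lin; auto.
  + intros; ring.
Qed.

Lemma comb_span n c : span (n + 1) (comb n c).
Proof.
apply (span_sum (n + 1) (fun i r => c i * basis n i r)); intros i Hi.
apply span_scal; unfold basis; destruct (Nat.leb_spec i n).
- apply span_pow; lia.
- apply span_log; [lia|].
  apply half_le; lia.
Qed.

Lemma comb_form n c r : (1 <= n <= 4)%nat -> comb n c r =
  match n with
  | 1%nat => form (c 0%nat) (c 1%nat) 0 0 0 (c 2%nat) 0 r
  | 2%nat => form (c 0%nat) (c 1%nat) (c 2%nat) 0 0 (c 3%nat) 0 r
  | 3%nat =>
    form (c 0%nat) (c 1%nat) (c 2%nat) (c 3%nat) 0 (c 4%nat) (c 5%nat) r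
  | _ => form (c 0%nat) (c 1%nat) (c 2%nat) (c 3%nat) (c 4%nat)
      (c 5%nat) (c 6%nat) r
  end.
Proof.
intros Hn; destruct n as [|[|[|[|[|n]]]]]; try lia;
unfold comb, form, basis; simpl; ring.
Qed.

(** The monomial count gives [n + 1] for [n <= 2], and [4 + 1] and [5 + 1] for [n = 3] and [n = 4],
    the summand [1] coming from [form_few_zeros2]. *)
Lemma comb_few_zeros n c : (1 <= n <= 4)%nat ->
  few_zeros (comb n c) (n + (n + 1) / 2).
Proof.
intros Hn.
assert (E := fun r => comb_form n c r Hn).
destruct n as [|[|[|[|[|n]]]]]; try lia;
  (apply few_zeros_ext with (1 := fun x => eq_sym (E x)));
  cbn [Nat.add Nat.div Nat.divmod fst].
- apply form_few_zeros1; [trivial|].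
  apply few_zeros_ext with (sparse ((c 0%nat + 2 * c 2%nat, 0%nat)
    :: (2 * c 1%nat, 1%nat) :: (c 0%nat - 2 * c 2%nat, 2%nat) :: nil)).
  { intros x; unfold form_num; simpl; ring. }
  apply sparse_few_zeros; simpl; [lia|].
  repeat constructor; unfold exp_le; simpl; lia.
- apply form_few_zeros1; [trivial|].
  apply few_zeros_ext with (sparse ((c 0%nat + 2 * c 3%nat, 0%nat)
    :: (2 * c 1%nat, 1%nat) :: (3 * c 2%nat + c 0%nat - 2 * c 3%nat, 2%nat)
    :: (- c 2%nat, 4%nat) :: nil)).
  { intros x; unfold form_num; simpl; ring. }
  apply sparse_few_zeros; simpl; [lia|].
  repeat constructor; unfold exp_le; simpl; lia.
- apply form_few_zeros2.
  apply few_zeros_ext with (sparse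
    ((- (c 0%nat + 2 * c 4%nat + 2 * c 5%nat), 0%nat) ::
     (6 * c 0%nat + 3 * c 2%nat + 8 * c 4%nat + 2 * c 5%nat, 2%nat) ::
     (8 * c 1%nat + 8 * c 3%nat, 3%nat) ::
     (3 * c 0%nat + 6 * c 2%nat - 6 * c 4%nat + 2 * c 5%nat, 4%nat) ::
     (- c 2%nat - 2 * c 5%nat, 6%nat) :: nil)).
  { intros x; unfold form_num2; simpl; ring. }
  apply sparse_few_zeros; simpl; [lia|].
  repeat constructor; unfold exp_le; simpl; lia.
- apply form_few_zeros2, sparse_few_zeros; simpl; [lia|].
  repeat constructor; unfold exp_le; simpl; lia.
Qed.

Lemma comb_zero n c : (1 <= n <= 4)%nat ->
  (forall r, 0 < r < 1 -> comb n c r = 0) ->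
  forall i, (i <= n + (n + 1) / 2)%nat -> c i = 0.
Proof.
intros Hn Z.
assert (E := fun r => comb_form n c r Hn).
destruct n as [|[|[|[|[|n]]]]]; try lia;
  (destruct (form_zero _ _ _ _ _ _ _
     (fun r Hr => eq_trans (eq_sym (E r)) (Z r Hr)))
     as (E0 & E1 & E2 & E3 & E4 & E5 & E6));
  cbn [Nat.add Nat.div Nat.divmod fst];
  intros [|[|[|[|[|[|[|i]]]]]]] Hi; trivial; lia.
Qed.

(** * From bounds in [r] to zero counts in [h] *)

Lemma Mbar_at_most M g k :
  (forall h, 0 < h < 1 -> M h = g (sqrt (1 - h))) ->
  (exists h, 0 < h < 1 /\ M h <> 0) ->
  few_zeros g k -> at_most M k.
Proof.
intros E (h & Hh & Nh) [H|H].
{ elim Nh; rewrite E by trivial; apply H, sqrt_one_minus, Hh. }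
intros z inc Z.
(* [sqrt (1 - h)] decreases in [h], so the zeros are taken in reverse order. *)
apply (H (fun i => sqrt (1 - z (k - i)%nat))).
- intros i Hi.
  destruct (Z (k - i)%nat ltac:(lia)) as [Hz _].
  apply sqrt_lt_1_alt; split; [lra|].
  replace (k - i)%nat with (S (k - S i)) by lia.
  generalize (inc (k - S i)%nat ltac:(lia)); lra.
- intros i Hi; destruct (Z (k - i)%nat ltac:(lia)) as [Hz Z0]; split.
  + now apply sqrt_one_minus.
  + now rewrite <- E.
Qed.

Lemma sorted_insert x l : StronglySorted Rlt l -> ~ In x l ->
  exists l', StronglySorted Rlt l' /\ length l' = S (length l) /\
    forall y, In y l' <-> y = x \/ In y l.
Proof.
intros S; induction S as [|a l S IH F]; intros N.
- exists (x :: nil); split; [repeat constructor|split; [trivial|]].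
  intros y; simpl; intuition auto.
- destruct (Rtotal_order x a) as [L|[->|L]].
  + exists (x :: a :: l); split; [|split; [trivial|]].
    * repeat constructor; trivial.
      revert F; apply Forall_impl; intros; lra.
    * intros y; simpl; intuition auto.
  + elim N; now left.
  + destruct IH as (l' & S' & Hl & I); [simpl in N; tauto|].
    exists (a :: l'); split; [|split].
    * constructor; trivial; apply Forall_forall; intros y Hy.
      apply I in Hy; destruct Hy as [->|Hy]; trivial.
      now apply (proj1 (Forall_forall _ l) F).
    * simpl; now rewrite Hl.
    * intros y; simpl; rewrite I; tauto.
Qed.

Lemma sorted_NoDup l : StronglySorted Rlt l -> NoDup l.
Proof.
intros S; induction S as [|a l S IH F]; constructor; trivial.
intros I; apply (Rlt_irrefl a), (proj1 (Forall_forall _ l) F), I.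
Qed.

Lemma sorted_nth l i : StronglySorted Rlt l -> (S i < length l)%nat ->
  nth i l 0 < nth (S i) l 0.
Proof.
intros S; revert i; induction S as [|a l S IH F]; simpl; intros i Hi; [lia|].
destruct i as [|i]; [|apply IH; lia].
apply (proj1 (Forall_forall _ l) F), nth_In; lia.
Qed.

(** Insert missed zeros into a sorted list until none is left; [at_most] bounds the length of such a
    list by [k]. *)
Lemma at_most_zero_count f k : at_most f k ->
  exists m, (m <= k)%nat /\ zero_count f m.
Proof.
intros H.
set (zeros l := StronglySorted Rlt l /\
  forall h, In h l -> 0 < h < 1 /\ f h = 0).
assert (B : forall l, zeros l -> (length l <= k)%nat).
{ intros l [S Z]; destruct (le_dec (length l) k) as [L|L]; trivial; exfalso.
  apply (H (fun i => nth i l 0)).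
  - intros i Hi; apply sorted_nth; trivial; lia.
  - intros i Hi; apply Z, nth_In; lia. }
(* [d] bounds the number of insertions still possible; at [d = 0] another one would exceed the
   bound. *)
assert (I : forall d l, zeros l -> (k - length l <= d)%nat ->
  exists m, (m <= k)%nat /\ zero_count f m).
{ induction d as [|d IH]; intros l Hl Hd;
  (destruct (classic (exists x, (0 < x < 1 /\ f x = 0) /\ ~ In x l))
     as [(x & Hx & Nx)|N];
   [destruct (sorted_insert x l (proj1 Hl) Nx) as (l' & S' & L' & I');
    assert (Z' : zeros l')
      by (split; trivial; intros y Hy; apply I' in Hy;
          destruct Hy as [->|Hy]; [trivial|now apply Hl]);
    specialize (B l' Z')
   |exists (length l); split; [now apply B|];
    exists l; split; [now apply sorted_NoDup, Hl|split; trivial];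
    intros y; split; [apply Hl|];
    intros Hy; apply NNPP; intros Ny; apply N; now exists y]).
  - lia.
  - apply (IH l'); trivial; lia. }
apply (I k nil); simpl; [|lia].
split; [constructor|intros h []].
Qed.

Theorem theorem1p2 (n : nat) (hn : (1 <= n <= 4)%nat) :
  is_Z n (n + (n + 1) / 2)%nat.
Proof.
assert (U : forall M, admissible n M -> at_most M (n + (n + 1) / 2)).
{ intros M [(pp & qp & pm & qm & Hpp & Hqp & Hpm & Hqm & ->) NZ].
  destruct (Mbar_in_span n pp qp pm qm) as (g & Sg & Eg); trivial.
  destruct (span_comb n g Sg) as [c Hc].
  apply Mbar_at_most with (comb n c); trivial.
  - intros h Hh; rewrite Eg by trivial; now apply Hc, sqrt_one_minus.
  - now apply comb_few_zeros. }
split; [|intros M HM; now apply at_most_zero_count, U].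
set (N := (n + (n + 1) / 2)%nat) in *.
(* Any [N] distinct points of (0,1) would do; these are equally spaced. *)
set (pt i := INR (S i) / INR (S N)).
assert (Hpt : forall i, (i < N)%nat -> 0 < pt i < 1).
{ intros i Hi; assert (0 < INR (S N)) by (apply lt_0_INR; lia).
  unfold pt; split.
  - apply Rdiv_lt_0_compat; trivial; apply lt_0_INR; lia.
  - apply Rlt_div_l; trivial; rewrite Rmult_1_l; apply lt_INR; lia. }
(* [N] vanishing conditions on [N + 1] coefficients. *)
destruct (homogeneous_solution N (fun i j => basis n i (sqrt (1 - pt j))))
  as (c & (i & Hi & Ci) & Hc).
destruct (realized_Mbar n (comb n c)) as (pp & qp & pm & qm & H1 & H2 & H3 & H4 & E).
{ apply span_realized; [lia|apply comb_span]. }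
assert (A : admissible n (Mbar pp qp pm qm)).
{ split; [now exists pp, qp, pm, qm|].
  (* If the function vanished on (0,1), linear independence would make every coefficient zero. *)
  apply NNPP; intros Z; apply Ci, (comb_zero n c hn); trivial.
  intros r Hr; apply NNPP; intros Nr; apply Z.
  exists (1 - r ^ 2); split; [nra|].
  rewrite E by nra.
  replace (1 - (1 - r ^ 2)) with (r ^ 2) by ring.
  rewrite sqrt_pow2 by lra; trivial. }
exists (Mbar pp qp pm qm); split; trivial.
(* The upper bound provides a finite zero count [k <= N]; the prescribed points give [N <= k]. *)
destruct (at_most_zero_count _ _ (U _ A)) as (k & Hk & l & Nd & Hl & Il).
enough (N <= k)%nat by (replace N with k by lia; now exists l).
rewrite <- Hl, <- (length_seq N 0), <- (length_map pt).
apply NoDup_incl_length.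
- apply NoDup_map_NoDup_ForallPairs; [|apply seq_NoDup].
  intros x y _ _ Exy; unfold pt in Exy.
  assert (0 < INR (S N)) by (apply lt_0_INR; lia).
  apply Rmult_eq_reg_r in Exy; [apply INR_eq in Exy; lia|].
  apply Rinv_neq_0_compat; lra.
- intros x Hx; apply in_map_iff in Hx; destruct Hx as (j & <- & Hj).
  apply in_seq in Hj; apply Il; split; [apply Hpt; lia|].
  rewrite E by (apply Hpt; lia); apply Hc; lia.
Qed.
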